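(* Let $p, q, r$ be distinct primes greater than $3$, and let $G \in M_2(\mathbb{Z}_{pqr}[x])$ be a non-trivial idempotent. Then $G$ is of one of the following forms, where $e(x), f(x), g(x), k(x)$ denote some polynomials in $\mathbb{Z}_{pqr}[x]$ and all equalities are in $\mathbb{Z}_{pqr}[x]$ (or $\mathbb{Z}_{pqr}$). (1) $\det G = 0$, and one of the following holds: (1a) $G = \begin{bmatrix} e(x) & f(x) \\ g(x) & 1-e(x) \end{bmatrix}$, where $e(x)(1-e(x)) - g(x)f(x) = 0$. (1b) $G = \begin{bmatrix} I e(x) & I f(x) \\ I g(x) & I(1-e(x)) \end{bmatrix}$, where $e(x)(1-e(x)) - g(x)f(x) = J k(x)$ and $(I,J)$ is one of the six pairs $((pq)^{r-1}, r)$, $((pr)^{q-1}, q)$, $((qr)^{p-1}, p)$, $(p^{(q-1)(r-1)}, qr)$, $(q^{(p-1)(r-1)}, pr)$, $(r^{(p-1)(q-1)}, pq)$. (2) For some $(a,b,c) \in \{(p,q,r),\ (q,r,p),\ (p,r,q)\}$ we have $\det G = (ab)^{c-1}$, and one of the following holds: (2a) $G = \begin{bmatrix} (ab)^{c-1} & 0 \\ 0 & (ab)^{c-1} \end{bmatrix}$. (2b) $G = \begin{bmatrix} 1 + c\,e(x) & c f(x) \\ c g(x) & (ab)^{c-1} - c\,e(x) \end{bmatrix}$, where $e(x)(1+c\,e(x)) + c\,g(x) f(x) = ab\,k(x)$. (2c) $G = \begin{bmatrix} u + ac\,e(x) & ac f(x) \\ ac\, g(x) & t - (u + ac\,e(x))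 \end{bmatrix}$, where $t = (2 - a^{b-1})(ab)^{c-1} + a^{b-1}$, $u$ is an integer with $u \equiv 0 \pmod a$ and $u \equiv 1 \pmod c$, and $(u+ac\,e(x))t - (u+ac\,e(x))^2 - (ac)^2 f(x) g(x) = (ab)^{c-1}$. (2d) The form obtained from (2c) by interchanging $a$ and $b$: $G = \begin{bmatrix} u + bc\,e(x) & bc f(x) \\ bc\, g(x) & t - (u + bc\,e(x)) \end{bmatrix}$, where $t = (2 - b^{a-1})(ab)^{c-1} + b^{a-1}$, $u$ is an integer with $u \equiv 0 \pmod b$ and $u \equiv 1 \pmod c$, and $(u+bc\,e(x))t - (u+bc\,e(x))^2 - (bc)^2 f(x) g(x) = (ab)^{c-1}$. (3) For some $(a,b,c) \in \{(p,q,r),\ (q,p,r),\ (r,p,q)\}$ we have $\det G = a^{(b-1)(c-1)}$, and one of the following holds: (3a) $G = \begin{bmatrix} a^{(b-1)(c-1)} & 0 \\ 0 & a^{(b-1)(c-1)} \end{bmatrix}$. (3b) $G = \begin{bmatrix} 1 + bc\,e(x) & bc f(x) \\ bc\,g(x) & a^{(b-1)(c-1)} - bc\,e(x) \end{bmatrix}$, where $e(x)(1 + bc\,e(x)) + bc f(x) g(x) = a\,k(x)$.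
   Context: $\mathbb{Z}_n$ denotes the ring $\mathbb{Z}/n\mathbb{Z}$ and $M_2(R)$ the ring of $2\times 2$ matrices over $R$. An element $G$ of a ring is idempotent if $G^2 = G$; an idempotent of $M_2(\mathbb{Z}_{pqr}[x])$ is non-trivial if it is neither the zero matrix nor the identity matrix. Integers are identified with their images in $\mathbb{Z}_{pqr} \subset \mathbb{Z}_{pqr}[x]$. *)

(* Defs.v *)
From mathcomp Require Export all_boot all_order all_algebra.

Set Implicit Arguments.
Unset Strict Implicit.
Unset Printing Implicit Defensive.

Import GRing.Theory.
Local Open Scope ring_scope.

(* The matrix with first row (a, b) and second row (c, d). *)
Definition mx2 (R : Type) (a b c d : R) : 'M[R]_2 :=
  \matrix_(i, j) if i == 0 then (if j == 0 then a else b)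
                 else (if j == 0 then c else d).

(* Main.v *)
Require Import Defs.
From HB Require Import structures.
From mathcomp Require Import all_boot all_order all_algebra.
From mathcomp Require Import cyclic ring.

Set Implicit Arguments.
Unset Strict Implicit.
Unset Printing Implicit Defensive.

Import GRing.Theory.
Local Open Scope ring_scope.

(** Reducing coefficients modulo p, q and r gives three ring morphisms from
    A = Z_pqr[x] to the integral domains F_p[x], F_q[x] and F_r[x].  By the
    Chinese remainder theorem they are jointly injective, and an element killed
    by several of them is a multiple of the product of the corresponding primes.

    Over an integral domain an idempotent 2 x 2 matrix is 0, or has trace 1
    and determinant 0, or is the identity: if the trace is not 1, the
    off-diagonal equations y(x + w) = y and z(x + w) = z force y = z = 0, and
    then x and w are equal elements of {0, 1} ([idempotent_local_rank]).  So
    an idempotent over A has a rank 0, 1 or 2 at each of the three primes, and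
    the normal forms of the theorem list the 27 triples of ranks up to the order
    of the primes; the triples 000 and 222 are the two trivial idempotents.
    The determinant is the element of A that is 1 at the primes of rank 2 and 0
    at the others, and Fermat's little theorem provides it: (ab)^(c-1) is 1
    at c only and a^((b-1)(c-1)) is 1 at b and c only
    ([one_prime_idempotent], [two_primes_idempotent]).

    Each normal form is then checked prime by prime.  The divisors of the
    entries in it come from the kernels of the reductions: for instance, if the
    rank is 2 at c, then G - 1 vanishes modulo c, whence the entries 1 + c e,
    c f, c g. *)

(** * Two-by-two matrices *)

Lemma mx2_eta (R : Type) (G : 'M[R]_2) :
  G = mx2 (G 0 0) (G 0 1) (G 1 0) (G 1 1).
Proof.
apply/matrixP=> i j; rewrite mxE.
by case: (splitP (i : 'I_(1 + 1))) => i' Ei;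
   case: (splitP (j : 'I_(1 + 1))) => j' Ej;
   rewrite -!val_eqE /= Ei Ej !ord1 /=; congr (G _ _); apply: val_inj;
   rewrite /= ?Ei ?Ej !ord1.
Qed.

Lemma det_mx2 (R : comNzRingType) (x y z w : R) :
  \det (mx2 x y z w) = x * w - y * z.
Proof.
rewrite (expand_det_row _ 0) big_ord_recl big_ord1 /cofactor !det_mx11 !mxE /=.
by rewrite expr0 expr1 mul1r mulN1r mulrN.
Qed.

Lemma mx2_idempotent (R : comNzRingType) (x y z w : R) :
  mx2 x y z w ^+ 2 = mx2 x y z w ->
  [/\ x * x + y * z = x, x * y + y * w = y, z * x + w * z = z
    & z * y + w * w = w].
Proof.
move=> E; split.
- by have := congr1 (fun M : 'M_2 => M 0 0) E;
    rewrite expr2 !mxE big_ord_recl big_ord1 !mxE.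
- by have := congr1 (fun M : 'M_2 => M 0 1) E;
    rewrite expr2 !mxE big_ord_recl big_ord1 !mxE.
- by have := congr1 (fun M : 'M_2 => M 1 0) E;
    rewrite expr2 !mxE big_ord_recl big_ord1 !mxE.
- by have := congr1 (fun M : 'M_2 => M 1 1) E;
    rewrite expr2 !mxE big_ord_recl big_ord1 !mxE.
Qed.

Lemma mx2_scalar (R : pzRingType) (s : R) : mx2 s 0 0 s = s%:M.
Proof.
rewrite [RHS]mx2_eta; congr mx2; by rewrite mxE.
Qed.

(** * Reduction modulo a prime *)

(** What is retained of a reduction A -> A / l is that its target is an integral
    domain and its kernel the ideal l A; the arguments below never look at
    the polynomials themselves, so they apply to any ring A with three such
    maps in which the product of the three primes is 0. *)
Record reduction (A : comNzRingType) (l : nat) := Reduction {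
  residue_ring : idomainType;
  reduce :> {rmorphism A -> residue_ring};
  reduction_prime : prime l;
  reduce_char : (reduce l%:R = 0);
  reduce_ker : forall x, reduce x = 0 -> exists k, x = l%:R * k }.

(** Representatives in {0, ..., n - 1} make the kernel explicit: a polynomial
    vanishes modulo l exactly when l divides all its representatives, and
    dividing each of them by l gives the cofactor. *)
Lemma reduction_polyZ (n l : nat) :
  (1 < n)%N -> prime l -> (l %| n)%N -> reduction {poly 'Z_n} l.
Proof.
move=> n1 l_pr ln.
have lF := pchar_Fp l_pr.
pose h (x : 'Z_n) : 'F_l := (x : nat)%:R.
have natr_mod (m : nat) : (m %% (Zp_trunc n).+2)%N%:R = m%:R :> 'F_l.
  rewrite (Zp_cast n1) [in RHS](divn_eq m n) natrD natrM.
  suff -> : n%:R = 0 :> 'F_l by rewrite mulr0 add0r.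
  by apply/eqP; rewrite -(dvdn_pcharf lF).
have hD : {morph h : x y / x + y}.
  by move=> x y; rewrite /h /= natr_mod natrD.
have hB : {morph h : x y / x - y}.
  move=> x y; apply: (addIr (h y)); rewrite -hD.
  by rewrite !subrK.
have hM : {morph h : x y / x * y}.
  by move=> x y; rewrite /h /= natr_mod natrM.
have h1 : h 1 = 1 by rewrite /h /= natr_mod.
pose add_h := GRing.isZmodMorphism.Build _ _ h hB.
pose mul_h := GRing.isMonoidMorphism.Build _ _ h (h1, hM).
pose rh : {rmorphism 'Z_n -> 'F_l} := HB.pack h add_h mul_h.
apply: (@Reduction _ _ _ (map_poly rh : {rmorphism _ -> {poly 'F_l}})) => //.
  rewrite rmorph_nat; apply/eqP; rewrite -polyC_natr polyC_eq0.
  by rewrite -(dvdn_pcharf lF).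
move=> x x0; exists (\poly_(i < size x) ((x`_i)%R %/ l)%N%:R).
apply/polyP=> i; rewrite mulr_natl coefMn coef_poly.
case: ltnP => [_|/(nth_default 0) ->]; last by rewrite mul0rn.
have /eqP : (map_poly rh x)`_i = 0 by rewrite x0 coef0.
rewrite coef_map /= /h -(dvdn_pcharf lF) => lx.
by rewrite -mulrnA divnK // natr_Zp.
Qed.

Section Reduction.

Variables (A : comNzRingType) (l : nat) (rho : reduction A l).

Lemma reduce_natX_dvd (m k : nat) :
  (l %| m)%N -> (0 < k)%N -> rho (m%:R ^+ k) = 0.
Proof.
case: k => // k /dvdnP[d ->] _.
by rewrite exprS natrM !rmorphM /= reduce_char mulr0 mul0r.
Qed.

(** Fermat's little theorem, read in the residue ring. *)
Lemma reduce_natX_coprime (m : nat) :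
  coprime m l -> rho (m%:R ^+ (l - 1)) = 1.
Proof.
move=> /Euler_exp_totient; rewrite totient_prime ?(reduction_prime rho) //.
rewrite subn1 => E.
rewrite -natrX (divn_eq (m ^ l.-1) l) E.
rewrite modn_small ?prime_gt1 ?(reduction_prime rho) //.
by rewrite natrD natrM rmorphD rmorphM /= reduce_char mulr0 add0r rmorph1.
Qed.

Lemma reduce_nat_neq0 (m : nat) : coprime m l -> rho m%:R != 0.
Proof.
move=> ml; apply/eqP=> m0; have := reduce_natX_coprime ml.
have l1 := prime_gt1 (reduction_prime rho).
rewrite rmorphXn /= m0 expr0n subn_eq0 leqNgt l1 /= => /esym/eqP.
by rewrite oner_eq0.
Qed.

(** The matrix with rows (x, y) and (z, w) reduces to the scalar matrix s. *)
Definition scalar_mod (s x y z w : A) :=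
  [/\ rho x = rho s, rho y = 0, rho z = 0 & rho w = rho s].

(** Trace 1 and determinant 0, with w eliminated: over a domain these are the
    idempotent matrices of rank 1. *)
Definition rank1_mod (x y z w : A) :=
  rho w = 1 - rho x /\ rho y * rho z = rho x * (1 - rho x).

Lemma scalar_mod_eq (s s' x y z w : A) :
  rho s = rho s' -> scalar_mod s x y z w -> scalar_mod s' x y z w.
Proof. by rewrite /scalar_mod => ->. Qed.

Inductive local_rank (x y z w : A) : Type :=
| Rank0 of scalar_mod 0 x y z w
| Rank1 of rank1_mod x y z w
| Rank2 of scalar_mod 1 x y z w.

(** The off-diagonal equations are y (x + w - 1) = 0 and z (x + w - 1) = 0.
    Either the trace x + w is 1, and the remaining equations say that the
    determinant vanishes, or y = z = 0 and the diagonal entries are idempotents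
    of a domain, with (0, 1) and (1, 0) excluded by the trace. *)
Lemma idempotent_local_rank (x y z w : A) :
  mx2 x y z w ^+ 2 = mx2 x y z w -> local_rank x y z w.
Proof.
case/mx2_idempotent => /(congr1 rho) Ex /(congr1 rho) Ey /(congr1 rho) Ez
  /(congr1 rho) Ew.
rewrite !(rmorphD, rmorphM) /= in Ex Ey Ez Ew.
case: (eqVneq (rho x + rho w) 1) => [xw|xw].
  apply: Rank1; split; first by rewrite -xw addrC addKr.
  by rewrite mulrBr mulr1 -{1}Ex addrC addKr.
have nz : rho x + rho w - 1 != 0 by rewrite subr_eq0.
have y0 : rho y = 0.
  apply: (mulIf nz); rewrite mul0r -[RHS](subrr (rho y)) -{2}Ey; ring.
have z0 : rho z = 0.
  apply: (mulIf nz); rewrite mul0r -[RHS](subrr (rho z)) -{2}Ez; ring.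
have idem (s : residue_ring rho) : s * s = s -> (s == 0) || (s == 1).
  by move=> Es; rewrite -(subr_eq0 s 1) -mulf_eq0 mulrBr mulr1 Es subrr.
rewrite y0 z0 mul0r ?addr0 ?add0r in Ex Ew.
have [/eqP x0|x0] := boolP (rho x == 0);
  have [/eqP w0|w0] := boolP (rho w == 0).
- by apply: Rank0; split; rewrite ?rmorph0.
- by move: (idem _ Ew) xw; rewrite (negPf w0) x0 /= => /eqP ->;
    rewrite add0r eqxx.
- by move: (idem _ Ex) xw; rewrite (negPf x0) w0 /= => /eqP ->;
    rewrite addr0 eqxx.
move: (idem _ Ex) (idem _ Ew); rewrite (negPf x0) (negPf w0) => /eqP x1 /eqP w1.
by apply: Rank2; split; rewrite ?rmorph1.
Qed.

End Reduction.

(** A Bezout relation u m = v n + 1 gives x = u m x - v n x, where both terms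
    are multiples of m n. *)
Lemma coprime_multiple (A : comNzRingType) (m n : nat) (x k k' : A) :
  (0 < m)%N -> coprime m n -> x = m%:R * k -> x = n%:R * k' ->
  exists h, x = (m * n)%:R * h.
Proof.
move=> m0 /(coprimeP _ m0)[[u v] /= uv] xk xk'.
have {}uv : (u * m = v * n + 1)%N.
  rewrite -uv addnC subnK //; apply: ltnW; rewrite -subn_gt0 uv //.
have E : u%:R * m%:R = v%:R * n%:R + 1 :> A by rewrite -!natrM uv natrD.
exists (u%:R * k' - v%:R * k).
have -> : (m * n)%:R * (u%:R * k' - v%:R * k) =
  u%:R * m%:R * (n%:R * k') - v%:R * n%:R * (m%:R * k) :> A.
  by rewrite natrM; ring.
by rewrite -xk -xk' E; ring.
Qed.

Section ReductionPairs.

Variable A : comNzRingType.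

Lemma reduction_coprime (m n : nat) :
  reduction A m -> reduction A n -> m != n -> coprime m n.
Proof.
move=> rm rn mn; rewrite prime_coprime ?(reduction_prime rm) //.
by rewrite dvdn_prime2 ?(reduction_prime rm) ?(reduction_prime rn).
Qed.

Lemma reduction_gt0 (m : nat) : reduction A m -> (0 < m)%N.
Proof. by move/reduction_prime/prime_gt0. Qed.

Lemma reduction_subn1_gt0 (m : nat) : reduction A m -> (0 < m - 1)%N.
Proof. by move/reduction_prime/prime_gt1; rewrite subn_gt0. Qed.

Lemma reduce_ker2 (m n : nat) (rm : reduction A m) (rn : reduction A n) s :
  m != n -> rm s = 0 -> rn s = 0 -> exists h, s = (m * n)%:R * h.
Proof.
move=> mn /reduce_ker[k sk] /reduce_ker[k' sk'].
exact: coprime_multiple (reduction_gt0 rm) (reduction_coprime rm rn mn) sk sk'.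
Qed.

(** Distinct primes are non-zero in each other's residue domains; this recovers
    congruences modulo a from equations that hold only after multiplication by
    c, as in the forms with entries 1 + c e, c f, c g. *)
Lemma reduce_cancel_nat (m n : nat) (rm : reduction A m) s :
  reduction A n -> n != m -> rm (n%:R * s) = 0 -> rm s = 0.
Proof.
move=> rn nm; rewrite rmorphM => /eqP; rewrite mulf_eq0.
by rewrite (negPf (reduce_nat_neq0 _ (reduction_coprime rn rm nm))) => /eqP.
Qed.

End ReductionPairs.

(** * The normal forms *)

(** In the name form_ijk the digits are the ranks at the primes a, b and c.  The
    remaining triples of ranks are obtained by permuting the primes. *)
Section Forms.

Variables (A : comNzRingType) (a b c : nat).
Variables (ra : reduction A a) (rb : reduction A b) (rc : reduction A c).
Hypotheses (neq_ab : a != b) (neq_ac : a != c) (neq_bc : b != c).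
Hypothesis abc0 : (a * b * c)%:R = 0 :> A.
Variables x y z w : A.

(** An element vanishing at the three primes is a multiple of a b c = 0. *)
Lemma reduce_inj (s t : A) : ra s = ra t -> rb s = rb t -> rc s = rc t -> s = t.
Proof.
move=> sa sb sc; apply/eqP; rewrite -subr_eq0; apply/eqP.
have [||h sh] := @reduce_ker2 _ _ _ ra rb (s - t) neq_ab.
- by rewrite rmorphB sa subrr.
- by rewrite rmorphB sb subrr.
have [|k sk] := @reduce_ker _ _ rc (s - t); first by rewrite rmorphB sc subrr.
have [||j ->] := coprime_multiple _ _ sh sk; last by rewrite abc0 mul0r.
  by rewrite muln_gt0 (reduction_gt0 ra) (reduction_gt0 rb).
by rewrite coprimeMl (reduction_coprime ra) ?(reduction_coprime rb).
Qed.

Lemma one_prime_idempotent :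
  [/\ ra ((a * b)%:R ^+ (c - 1)) = 0, rb ((a * b)%:R ^+ (c - 1)) = 0
    & rc ((a * b)%:R ^+ (c - 1)) = 1].
Proof.
split; first by rewrite reduce_natX_dvd ?dvdn_mulr ?(reduction_subn1_gt0 rc).
  by rewrite reduce_natX_dvd ?dvdn_mull ?(reduction_subn1_gt0 rc).
rewrite reduce_natX_coprime // coprimeMl.
by rewrite (reduction_coprime ra) ?(reduction_coprime rb).
Qed.

Lemma two_primes_idempotent :
  [/\ ra (a%:R ^+ ((b - 1) * (c - 1))) = 0,
      rb (a%:R ^+ ((b - 1) * (c - 1))) = 1
    & rc (a%:R ^+ ((b - 1) * (c - 1))) = 1].
Proof.
split.
- rewrite reduce_natX_dvd // muln_gt0.
  by rewrite (reduction_subn1_gt0 rb) (reduction_subn1_gt0 rc).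
- rewrite exprM rmorphXn /= reduce_natX_coprime ?expr1n //.
  exact: reduction_coprime ra rb neq_ab.
rewrite mulnC exprM rmorphXn /= reduce_natX_coprime ?expr1n //.
exact: reduction_coprime ra rc neq_ac.
Qed.

(* Turns an equation in A into its three reductions; the values of the entries
   at each prime then decide them. *)
Ltac reduce_entry :=
  apply: reduce_inj;
  rewrite ?(rmorphB, rmorphD, rmorphM, rmorph0, rmorph1, rmorphN) /=.

(** The equations of rank 1 have the same shape at all primes, so they lift to A
    without correction. *)
Lemma form_111 :
  rank1_mod ra x y z w -> rank1_mod rb x y z w -> rank1_mod rc x y z w ->
  \det (mx2 x y z w) = 0 /\
  exists e f g, mx2 x y z w = mx2 e f g (1 - e) /\ e * (1 - e) - g * f = 0.
Proof.
move=> [wa da] [wb db] [wc dc]; rewrite det_mx2.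
have -> : w = 1 - x by reduce_entry.
have d0 : x * (1 - x) - z * y = 0.
  by reduce_entry; rewrite -?(da, db, dc); ring.
by split; [rewrite [y * z]mulrC | exists x, y, z].
Qed.

(** The matrix vanishes where the idempotent I does, so multiplication by I
    leaves it unchanged; this is what allows w = I (1 - x), although w = 1 - x
    fails at a and b. *)
Lemma form_001 :
  scalar_mod ra 0 x y z w -> scalar_mod rb 0 x y z w -> rank1_mod rc x y z w ->
  \det (mx2 x y z w) = 0 /\
  exists e f g k, let I := ((a * b) ^ (c - 1))%N%:R in
    mx2 x y z w = mx2 (I * e) (I * f) (I * g) (I * (1 - e)) /\
    e * (1 - e) - g * f = c%:R * k.
Proof.
move=> [xa ya za wa] [xb yb zb wb] [wc dc]; rewrite det_mx2 natrX.
rewrite !rmorph0 in xa wa xb wb.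
have [Ia Ib Ic] := one_prime_idempotent; set I := _ ^+ _ in Ia Ib Ic *.
split.
  reduce_entry; rewrite ?(xa, ya, za, wa, xb, yb, zb, wb, wc, dc); ring.
have [|k Ek] := @reduce_ker _ _ rc (x * (1 - x) - z * y).
  by rewrite !(rmorphB, rmorphM, rmorph1) /= -dc; ring.
exists x, y, z, k; split=> //=.
congr mx2; reduce_entry;
  rewrite ?(xa, ya, za, wa, xb, yb, zb, wb, wc, Ia, Ib, Ic); ring.
Qed.

Lemma form_011 :
  scalar_mod ra 0 x y z w -> rank1_mod rb x y z w -> rank1_mod rc x y z w ->
  \det (mx2 x y z w) = 0 /\
  exists e f g k, let I := (a ^ ((b - 1) * (c - 1)))%N%:R in
    mx2 x y z w = mx2 (I * e) (I * f) (I * g) (I * (1 - e)) /\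
    e * (1 - e) - g * f = (b * c)%:R * k.
Proof.
move=> [xa ya za wa] [wb db] [wc dc]; rewrite det_mx2 natrX.
rewrite !rmorph0 in xa wa.
have [Ia Ib Ic] := two_primes_idempotent; set I := _ ^+ _ in Ia Ib Ic *.
split.
  reduce_entry; rewrite ?(xa, ya, za, wa, wb, db, wc, dc); ring.
have [||k Ek] := @reduce_ker2 _ _ _ rb rc (x * (1 - x) - z * y) neq_bc.
- by rewrite !(rmorphB, rmorphM, rmorph1) /= -db; ring.
- by rewrite !(rmorphB, rmorphM, rmorph1) /= -dc; ring.
exists x, y, z, k; split=> //=.
congr mx2; reduce_entry;
  rewrite ?(xa, ya, za, wa, wb, wc, Ia, Ib, Ic); ring.
Qed.

Lemma form_scalar (s : A) :
  s * s = s ->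
  scalar_mod ra s x y z w -> scalar_mod rb s x y z w ->
  scalar_mod rc s x y z w ->
  \det (mx2 x y z w) = s /\ mx2 x y z w = mx2 s 0 0 s.
Proof.
move=> ss [xa ya za wa] [xb yb zb wb] [xc yc zc wc].
have -> : mx2 x y z w = mx2 s 0 0 s.
  congr mx2; reduce_entry;
    by rewrite ?(xa, ya, za, wa, xb, yb, zb, wb, xc, yc, zc, wc).
by rewrite det_mx2 ss mul0r subr0.
Qed.

Lemma form_002 :
  scalar_mod ra 0 x y z w -> scalar_mod rb 0 x y z w ->
  scalar_mod rc 1 x y z w ->
  let I := (a * b)%:R ^+ (c - 1) in
  \det (mx2 x y z w) = I /\ mx2 x y z w = mx2 I 0 0 I.
Proof.
move=> sa sb sc I.
have [Ia Ib Ic] := one_prime_idempotent;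
  rewrite -/I in Ia Ib Ic.
apply: form_scalar.
- by reduce_entry; rewrite ?(Ia, Ib, Ic) ?mulr0 ?mulr1.
- by apply: scalar_mod_eq sa; rewrite rmorph0 Ia.
- by apply: scalar_mod_eq sb; rewrite rmorph0 Ib.
- by apply: scalar_mod_eq sc; rewrite rmorph1 Ic.
Qed.

(** Dividing G - 1 by c produces e, f and g.  Multiplied by c, the equation
    between them becomes x (1 - x) = y z, which holds at a and b, where c is
    cancelled. *)
Lemma form_112 :
  rank1_mod ra x y z w -> rank1_mod rb x y z w -> scalar_mod rc 1 x y z w ->
  let I := (a * b)%:R ^+ (c - 1) in
  \det (mx2 x y z w) = I /\
  exists e f g k,
    mx2 x y z w = mx2 (1 + c%:R * e) (c%:R * f) (c%:R * g) (I - c%:R * e) /\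
    e * (1 + c%:R * e) + c%:R * g * f = (a * b)%:R * k.
Proof.
move=> [wa da] [wb db] [xc yc zc wc]; rewrite det_mx2 /=.
rewrite !rmorph1 in xc wc.
have [Ia Ib Ic] := one_prime_idempotent; set I := _ ^+ _ in Ia Ib Ic *.
split.
  reduce_entry; rewrite ?(wa, da, wb, db, xc, yc, zc, wc, Ia, Ib, Ic); ring.
have [|e Ee] := @reduce_ker _ _ rc (x - 1).
  by rewrite rmorphB rmorph1 xc subrr.
have [f Ef] := reduce_ker yc; have [g Eg] := reduce_ker zc.
have Ek : c%:R * (e * (1 + c%:R * e) + c%:R * g * f) = (x - 1) * x + z * y.
  by rewrite Ef Eg -[x](subrK 1) Ee; ring.
have [||k Hk] :=
    @reduce_ker2 _ _ _ ra rb (e * (1 + c%:R * e) + c%:R * g * f) neq_ab.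
- apply: (reduce_cancel_nat rc); first by rewrite eq_sym.
  rewrite Ek !(rmorphB, rmorphD, rmorphM, rmorph1) /=.
  by rewrite [ra z * _]mulrC da; ring.
- apply: (reduce_cancel_nat rc); first by rewrite eq_sym.
  rewrite Ek !(rmorphB, rmorphD, rmorphM, rmorph1) /=.
  by rewrite [rb z * _]mulrC db; ring.
exists e, f, g, k; split=> //; rewrite -Ee -Ef -Eg addrC subrK; congr mx2.
by reduce_entry; rewrite ?(wa, wb, xc, wc, Ia, Ib, Ic); ring.
Qed.

(** The integer u = a^(c-1) has the residues 0 at a and 1 at c of the
    diagonal entry x, so that x - u, y and z are multiples of a c.  The element
    t is the trace: it is 0 at a, 1 at b and 2 at c.  The last equation
    is x w - y z = I with w = t - x. *)
Lemma form_012 :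
  scalar_mod ra 0 x y z w -> rank1_mod rb x y z w -> scalar_mod rc 1 x y z w ->
  let I := (a * b)%:R ^+ (c - 1) in
  \det (mx2 x y z w) = I /\
  exists (u : int) (t e f g : A),
  [/\ t = (2 - a%:R ^+ (b - 1)) * I + a%:R ^+ (b - 1),
      (u = 0 %[mod a%:Z])%Z, (u = 1 %[mod c%:Z])%Z,
      mx2 x y z w = mx2 (u%:~R + (a * c)%:R * e) ((a * c)%:R * f)
                        ((a * c)%:R * g) (t - (u%:~R + (a * c)%:R * e))
    & (u%:~R + (a * c)%:R * e) * t - (u%:~R + (a * c)%:R * e) ^+ 2
      - (a * c)%:R ^+ 2 * f * g = I].
Proof.
move=> [xa ya za wa] [wb db] [xc yc zc wc] I.
rewrite !(rmorph0, rmorph1) in xa wa xc wc.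
have [Ia Ib Ic] := one_prime_idempotent;
  rewrite -/I in Ia Ib Ic.
have dI : \det (mx2 x y z w) = I.
  rewrite det_mx2; reduce_entry;
    rewrite ?(xa, ya, za, wa, wb, db, xc, yc, zc, wc);
    rewrite ?(Ia, Ib, Ic); ring.
split=> //.
pose v : A := a%:R ^+ (c - 1).
have va : ra v = 0 by rewrite reduce_natX_dvd ?(reduction_subn1_gt0 rc).
have vc : rc v = 1 by rewrite reduce_natX_coprime ?(reduction_coprime ra rc).
have [||e Ee] := @reduce_ker2 _ _ _ ra rc (x - v) neq_ac.
- by rewrite rmorphB xa va subrr.
- by rewrite rmorphB xc vc subrr.
have [f Ef] := reduce_ker2 neq_ac ya yc.
have [g Eg] := reduce_ker2 neq_ac za zc.
have uv : (a ^ (c - 1))%N%:Z%:~R = v by rewrite -pmulrn natrX.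
set t := (2 - a%:R ^+ (b - 1)) * I + a%:R ^+ (b - 1).
have wt : w = t - x.
  have sa : ra (a%:R ^+ (b - 1)) = 0.
    by rewrite reduce_natX_dvd ?(reduction_subn1_gt0 rb).
  have sb : rb (a%:R ^+ (b - 1)) = 1.
    by rewrite reduce_natX_coprime ?(reduction_coprime ra rb).
  rewrite /t; set s := a%:R ^+ (b - 1) in sa sb *.
  by reduce_entry;
    rewrite ?(xa, wa, wb, xc, wc, Ia, Ib, Ic, sa, sb) ?rmorph_nat; ring.
have vx : v + (a * c)%:R * e = x by rewrite -Ee addrC subrK.
exists (a ^ (c - 1))%N, t, e, f, g; rewrite uv vx -Ef -Eg -wt.
split=> //.
- rewrite !modz_nat mod0n; congr Posz; apply/eqP.
  by rewrite -/(dvdn _ _) dvdn_exp ?(reduction_subn1_gt0 rc).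
- rewrite !modz_nat; congr Posz.
  have /Euler_exp_totient := reduction_coprime ra rc neq_ac.
  by rewrite totient_prime ?(reduction_prime rc) // subn1.
by rewrite -dI det_mx2 wt Ef Eg; ring.
Qed.

Lemma form_022 :
  scalar_mod ra 0 x y z w -> scalar_mod rb 1 x y z w ->
  scalar_mod rc 1 x y z w ->
  let I := a%:R ^+ ((b - 1) * (c - 1)) in
  \det (mx2 x y z w) = I /\ mx2 x y z w = mx2 I 0 0 I.
Proof.
move=> sa sb sc I.
have [Ia Ib Ic] := two_primes_idempotent;
  rewrite -/I in Ia Ib Ic.
apply: form_scalar.
- by reduce_entry; rewrite ?(Ia, Ib, Ic) ?mulr0 ?mulr1.
- by apply: scalar_mod_eq sa; rewrite rmorph0 Ia.
- by apply: scalar_mod_eq sb; rewrite rmorph1 Ib.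
- by apply: scalar_mod_eq sc; rewrite rmorph1 Ic.
Qed.

(** As for ranks (1, 1, 2), now dividing G - 1 by b c and cancelling the two
    factors one after the other. *)
Lemma form_122 :
  rank1_mod ra x y z w -> scalar_mod rb 1 x y z w -> scalar_mod rc 1 x y z w ->
  let I := a%:R ^+ ((b - 1) * (c - 1)) in
  \det (mx2 x y z w) = I /\
  exists e f g k,
    mx2 x y z w = mx2 (1 + (b * c)%:R * e) ((b * c)%:R * f) ((b * c)%:R * g)
                      (I - (b * c)%:R * e) /\
    e * (1 + (b * c)%:R * e) + (b * c)%:R * f * g = a%:R * k.
Proof.
move=> [wa da] [xb yb zb wb] [xc yc zc wc]; rewrite det_mx2 /=.
rewrite !rmorph1 in xb wb xc wc.
have [Ia Ib Ic] := two_primes_idempotent; set I := _ ^+ _ in Ia Ib Ic *.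
split.
  reduce_entry;
    rewrite ?(wa, da, xb, yb, zb, wb, xc, yc, zc, wc, Ia, Ib, Ic); ring.
have [||e Ee] := @reduce_ker2 _ _ _ rb rc (x - 1) neq_bc.
- by rewrite rmorphB rmorph1 xb subrr.
- by rewrite rmorphB rmorph1 xc subrr.
have [f Ef] := reduce_ker2 neq_bc yb yc.
have [g Eg] := reduce_ker2 neq_bc zb zc.
have Ek : b%:R * (c%:R * (e * (1 + (b * c)%:R * e) + (b * c)%:R * f * g))
          = (x - 1) * x + y * z.
  by rewrite Ef Eg -[x](subrK 1) Ee natrM; ring.
have [|k Hk] :=
    @reduce_ker _ _ ra (e * (1 + (b * c)%:R * e) + (b * c)%:R * f * g).
  apply: (reduce_cancel_nat rc); first by rewrite eq_sym.
  apply: (reduce_cancel_nat rb); first by rewrite eq_sym.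
  by rewrite Ek !(rmorphB, rmorphD, rmorphM, rmorph1) /= da; ring.
exists e, f, g, k; split=> //; rewrite -Ee -Ef -Eg addrC subrK; congr mx2.
by reduce_entry; rewrite ?(wa, xb, wb, xc, wc, Ia, Ib, Ic); ring.
Qed.

End Forms.

(** * Assembling the prime components *)

Definition forms_rank2_at_one (A : comNzRingType) (a b c : nat) (G : 'M[A]_2) :=
  [\/ G = mx2 ((a * b)%:R ^+ (c - 1)) 0 0 ((a * b)%:R ^+ (c - 1)),
      exists e f g k : A,
        G = mx2 (1 + c%:R * e) (c%:R * f)
                (c%:R * g) ((a * b)%:R ^+ (c - 1) - c%:R * e)
        /\ e * (1 + c%:R * e) + c%:R * g * f = (a * b)%:R * k,
      exists (u : int) (t e f g : A),
        [/\ t = (2 - a%:R ^+ (b - 1)) * (a * b)%:R ^+ (c - 1)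
                + a%:R ^+ (b - 1),
            (u = 0 %[mod a%:Z])%Z, (u = 1 %[mod c%:Z])%Z,
            G = mx2 (u%:~R + (a * c)%:R * e) ((a * c)%:R * f)
                    ((a * c)%:R * g) (t - (u%:~R + (a * c)%:R * e))
          & (u%:~R + (a * c)%:R * e) * t - (u%:~R + (a * c)%:R * e) ^+ 2
            - (a * c)%:R ^+ 2 * f * g = (a * b)%:R ^+ (c - 1)]
    | exists (u : int) (t e f g : A),
        [/\ t = (2 - b%:R ^+ (a - 1)) * (a * b)%:R ^+ (c - 1)
                + b%:R ^+ (a - 1),
            (u = 0 %[mod b%:Z])%Z, (u = 1 %[mod c%:Z])%Z,
            G = mx2 (u%:~R + (b * c)%:R * e) ((b * c)%:R * f)
                    ((b * c)%:R * g) (t - (u%:~R + (b * c)%:R * e))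
          & (u%:~R + (b * c)%:R * e) * t - (u%:~R + (b * c)%:R * e) ^+ 2
            - (b * c)%:R ^+ 2 * f * g = (a * b)%:R ^+ (c - 1)]].

Definition forms_rank2_at_two (A : comNzRingType) (a b c : nat) (G : 'M[A]_2) :=
  G = mx2 (a%:R ^+ ((b - 1) * (c - 1))) 0 0 (a%:R ^+ ((b - 1) * (c - 1)))
  \/ exists e f g k : A,
       G = mx2 (1 + (b * c)%:R * e) ((b * c)%:R * f) ((b * c)%:R * g)
               (a%:R ^+ ((b - 1) * (c - 1)) - (b * c)%:R * e)
       /\ e * (1 + (b * c)%:R * e) + (b * c)%:R * f * g = a%:R * k.

Section Assembly.

Variables (A : comNzRingType) (a b c : nat).
Variables (ra : reduction A a) (rb : reduction A b) (rc : reduction A c).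
Hypotheses (neq_ab : a != b) (neq_ac : a != c) (neq_bc : b != c).
Hypothesis abc0 : (a * b * c)%:R = 0 :> A.
Variables x y z w : A.

(** Ranks (1, 0, 2) are ranks (0, 1, 2) with a and b exchanged. *)
Lemma rank2_at_one_prime :
  scalar_mod ra 0 x y z w \/ rank1_mod ra x y z w ->
  scalar_mod rb 0 x y z w \/ rank1_mod rb x y z w ->
  scalar_mod rc 1 x y z w ->
  \det (mx2 x y z w) = (a * b)%:R ^+ (c - 1) /\
  forms_rank2_at_one a b c (mx2 x y z w).
Proof.
move=> [ka|ka] [kb|kb] kc.
- by have [dG EG] := form_002 neq_ab neq_ac neq_bc abc0 ka kb kc;
    split=> //; constructor 1.
- by have [dG EG] := form_012 neq_ab neq_ac neq_bc abc0 ka kb kc;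
    split=> //; constructor 3.
- have neq_ba : b != a by rewrite eq_sym.
  have bac0 : (b * a * c)%:R = 0 :> A by rewrite [(b * a)%N]mulnC.
  have := form_012 neq_ba neq_bc neq_ac bac0 kb ka kc.
  by rewrite [(b * a)%N]mulnC => -[dG EG]; split=> //; constructor 4.
- by have [dG EG] := form_112 neq_ab neq_ac neq_bc abc0 ka kb kc;
    split=> //; constructor 2.
Qed.

Lemma rank2_at_two_primes :
  scalar_mod ra 0 x y z w \/ rank1_mod ra x y z w ->
  scalar_mod rb 1 x y z w -> scalar_mod rc 1 x y z w ->
  \det (mx2 x y z w) = a%:R ^+ ((b - 1) * (c - 1)) /\
  forms_rank2_at_two a b c (mx2 x y z w).
Proof.
move=> [ka|ka] kb kc.
- by have [dG EG] := form_022 neq_ab neq_ac neq_bc abc0 ka kb kc;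
    split=> //; left.
- by have [dG EG] := form_122 neq_ab neq_ac neq_bc abc0 ka kb kc;
    split=> //; right.
Qed.

End Assembly.

Theorem theorem3p1 (p q r : nat)
  (hp : prime p) (hq : prime q) (hr : prime r)
  (hp3 : (3 < p)%N) (hq3 : (3 < q)%N) (hr3 : (3 < r)%N)
  (hpq : p <> q) (hpr : p <> r) (hqr : q <> r)
  (G : 'M[{poly 'Z_(p * q * r)}]_2)
  (hG : G ^+ 2 = G) (hG0 : G <> 0) (hG1 : G <> 1) :
  (* (1) *)
  (\det G = 0 /\
    ((* (1a) *)
     (exists e f g : {poly 'Z_(p * q * r)},
        G = mx2 e f g (1 - e) /\ e * (1 - e) - g * f = 0)
     \/ (* (1b) *)
     (exists (I J : nat) (e f g k : {poly 'Z_(p * q * r)}),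
        [/\ (I, J) \in [:: (((p * q) ^ (r - 1))%N, r);
                           (((p * r) ^ (q - 1))%N, q);
                           (((q * r) ^ (p - 1))%N, p);
                           ((p ^ ((q - 1) * (r - 1)))%N, (q * r)%N);
                           ((q ^ ((p - 1) * (r - 1)))%N, (p * r)%N);
                           ((r ^ ((p - 1) * (q - 1)))%N, (p * q)%N)],
            G = mx2 (I%:R * e) (I%:R * f) (I%:R * g) (I%:R * (1 - e))
          & e * (1 - e) - g * f = J%:R * k])))
  \/
  (* (2) *)
  (exists a b c : nat,
    [/\ (a, b, c) \in [:: (p, q, r); (q, r, p); (p, r, q)],
        \det G = (a * b)%:R ^+ (c - 1)
      & [\/ (* (2a) *)
            G = mx2 ((a * b)%:R ^+ (c - 1)) 0 0 ((a * b)%:R ^+ (c - 1)),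
            (* (2b) *)
            exists e f g k : {poly 'Z_(p * q * r)},
              G = mx2 (1 + c%:R * e) (c%:R * f)
                      (c%:R * g) ((a * b)%:R ^+ (c - 1) - c%:R * e)
              /\ e * (1 + c%:R * e) + c%:R * g * f = (a * b)%:R * k,
            (* (2c) *)
            exists (u : int) (t e f g : {poly 'Z_(p * q * r)}),
              [/\ t = (2 - a%:R ^+ (b - 1)) * (a * b)%:R ^+ (c - 1)
                      + a%:R ^+ (b - 1),
                  (u = 0 %[mod a%:Z])%Z,
                  (u = 1 %[mod c%:Z])%Z,
                  G = mx2 (u%:~R + (a * c)%:R * e) ((a * c)%:R * f)
                          ((a * c)%:R * g) (t - (u%:~R + (a * c)%:R * e))
                & (u%:~R + (a * c)%:R * e) * t
                    - (u%:~R + (a * c)%:R * e) ^+ 2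
                    - (a * c)%:R ^+ 2 * f * g = (a * b)%:R ^+ (c - 1)]
          | (* (2d) *)
            exists (u : int) (t e f g : {poly 'Z_(p * q * r)}),
              [/\ t = (2 - b%:R ^+ (a - 1)) * (a * b)%:R ^+ (c - 1)
                      + b%:R ^+ (a - 1),
                  (u = 0 %[mod b%:Z])%Z,
                  (u = 1 %[mod c%:Z])%Z,
                  G = mx2 (u%:~R + (b * c)%:R * e) ((b * c)%:R * f)
                          ((b * c)%:R * g) (t - (u%:~R + (b * c)%:R * e))
                & (u%:~R + (b * c)%:R * e) * t
                    - (u%:~R + (b * c)%:R * e) ^+ 2
                    - (b * c)%:R ^+ 2 * f * g = (a * b)%:R ^+ (c - 1)]]])
  \/
  (* (3) *)
  (exists a b c : nat,
    [/\ (a, b, c) \in [:: (p, q, r); (q, p, r); (r, p, q)],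
        \det G = a%:R ^+ ((b - 1) * (c - 1))
      & (* (3a) *)
        G = mx2 (a%:R ^+ ((b - 1) * (c - 1))) 0
                0 (a%:R ^+ ((b - 1) * (c - 1)))
        \/ (* (3b) *)
        (exists e f g k : {poly 'Z_(p * q * r)},
           G = mx2 (1 + (b * c)%:R * e) ((b * c)%:R * f)
                   ((b * c)%:R * g)
                   (a%:R ^+ ((b - 1) * (c - 1)) - (b * c)%:R * e)
           /\ e * (1 + (b * c)%:R * e) + (b * c)%:R * f * g = a%:R * k)]).
Proof.
have neq_pq : p != q by apply/eqP.
have neq_pr : p != r by apply/eqP.
have neq_qr : q != r by apply/eqP.
have neq_qp : q != p by rewrite eq_sym.
have neq_rp : r != p by rewrite eq_sym.
have neq_rq : r != q by rewrite eq_sym.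
have r1 := prime_gt1 hr.
have n1 : (1 < p * q * r)%N.
  by apply: leq_trans r1 _; rewrite leq_pmull // muln_gt0 !prime_gt0.
have rp : reduction {poly 'Z_(p * q * r)} p.
  by apply: reduction_polyZ; rewrite // -mulnA dvdn_mulr.
have rq : reduction {poly 'Z_(p * q * r)} q.
  by apply: reduction_polyZ; rewrite // mulnAC dvdn_mull.
have rr : reduction {poly 'Z_(p * q * r)} r.
  by apply: reduction_polyZ; rewrite // dvdn_mull.
have pqr0 : (p * q * r)%:R = 0 :> {poly 'Z_(p * q * r)}.
  by rewrite -polyC_natr; apply/eqP; rewrite polyC_eq0 pchar_Zp.
have qrp0 : (q * r * p)%:R = 0 :> {poly 'Z_(p * q * r)}.
  by have -> : (q * r * p = p * q * r)%N by rewrite [LHS]mulnC mulnA.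
have prq0 : (p * r * q)%:R = 0 :> {poly 'Z_(p * q * r)}.
  by have -> : (p * r * q = p * q * r)%N by rewrite [LHS]mulnAC.
have qpr0 : (q * p * r)%:R = 0 :> {poly 'Z_(p * q * r)}.
  by have -> : (q * p * r = p * q * r)%N by rewrite [(q * p)%N]mulnC.
have rpq0 : (r * p * q)%:R = 0 :> {poly 'Z_(p * q * r)}.
  by have -> : (r * p * q = p * q * r)%N by rewrite -mulnA mulnC.
move: hG hG0 hG1; rewrite [G]mx2_eta.
move: (G 0 0) (G 0 1) (G 1 0) (G 1 1) => x y z w hG hG0 hG1 {G}.
set M := mx2 x y z w in hG hG0 hG1 *.
pose pairs := [:: (((p * q) ^ (r - 1))%N, r); (((p * r) ^ (q - 1))%N, q);
   (((q * r) ^ (p - 1))%N, p); ((p ^ ((q - 1) * (r - 1)))%N, (q * r)%N);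
   ((q ^ ((p - 1) * (r - 1)))%N, (p * r)%N);
   ((r ^ ((p - 1) * (q - 1)))%N, (p * q)%N)].
(* Naming the conclusion leaves the 27 cases with only the choice of a, b, c. *)
set goal := _ \/ _.
have case1b I J : (I, J) \in pairs ->
    (\det M = 0 /\ exists e f g k : {poly 'Z_(p * q * r)},
      M = mx2 (I%:R * e) (I%:R * f) (I%:R * g) (I%:R * (1 - e)) /\
      e * (1 - e) - g * f = J%:R * k) -> goal.
  move=> IJ [dG [e [f [g [k [EG Ek]]]]]]; left; split=> //; right.
  by exists I, J, e, f, g, k.
have case2 a b c : (a, b, c) \in [:: (p, q, r); (q, r, p); (p, r, q)] ->
    (\det M = (a * b)%:R ^+ (c - 1) /\ forms_rank2_at_one a b c M) -> goal.
  by move=> abc [dG EG]; right; left; exists a, b, c.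
have case3 a b c : (a, b, c) \in [:: (p, q, r); (q, p, r); (r, p, q)] ->
    (\det M = a%:R ^+ ((b - 1) * (c - 1)) /\ forms_rank2_at_two a b c M) ->
    goal.
  by move=> abc [dG EG]; right; right; exists a, b, c.
have pq_r := rank2_at_one_prime (ra := rp) (rb := rq) (rc := rr)
  (x := x) (y := y) (z := z) (w := w)
  neq_pq neq_pr neq_qr pqr0.
have qr_p := rank2_at_one_prime (ra := rq) (rb := rr) (rc := rp)
  (x := x) (y := y) (z := z) (w := w)
  neq_qr neq_qp neq_rp qrp0.
have pr_q := rank2_at_one_prime (ra := rp) (rb := rr) (rc := rq)
  (x := x) (y := y) (z := z) (w := w)
  neq_pr neq_pq neq_rq prq0.
have p_qr := rank2_at_two_primes (ra := rp) (rb := rq) (rc := rr)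
  (x := x) (y := y) (z := z) (w := w)
  neq_pq neq_pr neq_qr pqr0.
have q_pr := rank2_at_two_primes (ra := rq) (rb := rp) (rc := rr)
  (x := x) (y := y) (z := z) (w := w)
  neq_qp neq_qr neq_pr qpr0.
have r_pq := rank2_at_two_primes (ra := rr) (rb := rp) (rc := rq)
  (x := x) (y := y) (z := z) (w := w)
  neq_rp neq_rq neq_pq rpq0.
have [kp|kp|kp] := idempotent_local_rank rp hG;
have [kq|kq|kq] := idempotent_local_rank rq hG;
have [kr|kr|kr] := idempotent_local_rank rr hG.
- case: hG0; rewrite /M.
  have [_ ->] := form_scalar neq_pq neq_pr neq_qr pqr0 (mul0r 0) kp kq kr.
  by rewrite mx2_scalar raddf0.
- apply: (case1b ((p * q) ^ (r - 1))%N r); first by rewrite !inE eqxx.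
  exact (form_001 neq_pq neq_pr neq_qr pqr0 kp kq kr).
- apply: (case2 p q r); [by rewrite !inE eqxx | by apply: pq_r; auto].
- apply: (case1b ((p * r) ^ (q - 1))%N q); first by rewrite !inE eqxx ?orbT.
  exact (form_001 neq_pr neq_pq neq_rq prq0 kp kr kq).
- apply: (case1b (p ^ ((q - 1) * (r - 1)))%N (q * r)%N).
    by rewrite !inE eqxx ?orbT.
  exact (form_011 neq_pq neq_pr neq_qr pqr0 kp kq kr).
- apply: (case2 p q r); [by rewrite !inE eqxx | by apply: pq_r; auto].
- apply: (case2 p r q); [by rewrite !inE eqxx ?orbT | by apply: pr_q; auto].
- apply: (case2 p r q); [by rewrite !inE eqxx ?orbT | by apply: pr_q; auto].
- apply: (case3 p q r); [by rewrite !inE eqxx | by apply: p_qr; auto].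
- apply: (case1b ((q * r) ^ (p - 1))%N p); first by rewrite !inE eqxx ?orbT.
  exact (form_001 neq_qr neq_qp neq_rp qrp0 kq kr kp).
- apply: (case1b (q ^ ((p - 1) * (r - 1)))%N (p * r)%N).
    by rewrite !inE eqxx ?orbT.
  exact (form_011 neq_qp neq_qr neq_pr qpr0 kq kp kr).
- apply: (case2 p q r); [by rewrite !inE eqxx | by apply: pq_r; auto].
- apply: (case1b (r ^ ((p - 1) * (q - 1)))%N (p * q)%N).
    by rewrite !inE eqxx ?orbT.
  exact (form_011 neq_rp neq_rq neq_pq rpq0 kr kp kq).
- have [dG [e [f [g EG]]]] := form_111 neq_pq neq_pr neq_qr pqr0 kp kq kr.
  by left; split=> //; left; exists e, f, g.
- apply: (case2 p q r); [by rewrite !inE eqxx | by apply: pq_r; auto].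
- apply: (case2 p r q); [by rewrite !inE eqxx ?orbT | by apply: pr_q; auto].
- apply: (case2 p r q); [by rewrite !inE eqxx ?orbT | by apply: pr_q; auto].
- apply: (case3 p q r); [by rewrite !inE eqxx | by apply: p_qr; auto].
- apply: (case2 q r p); [by rewrite !inE eqxx ?orbT | by apply: qr_p; auto].
- apply: (case2 q r p); [by rewrite !inE eqxx ?orbT | by apply: qr_p; auto].
- apply: (case3 q p r); [by rewrite !inE eqxx ?orbT | by apply: q_pr; auto].
- apply: (case2 q r p); [by rewrite !inE eqxx ?orbT | by apply: qr_p; auto].
- apply: (case2 q r p); [by rewrite !inE eqxx ?orbT | by apply: qr_p; auto].
- apply: (case3 q p r); [by rewrite !inE eqxx ?orbT | by apply: q_pr; auto].
- apply: (case3 r p q); [by rewrite !inE eqxx ?orbT | by apply: r_pq; auto].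
- apply: (case3 r p q); [by rewrite !inE eqxx ?orbT | by apply: r_pq; auto].
- case: hG1; rewrite /M.
  have [_ ->] := form_scalar neq_pq neq_pr neq_qr pqr0 (mul1r 1) kp kq kr.
  exact: mx2_scalar.
Qed.
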